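(* Let $\Gamma=\Gamma_p$ for some $1<p\leq 2$, and let $u$ be a (continuous) viscosity solution of $$\lambda(A^u)\in\partial\Gamma\quad\text{in}\ \mathbb{R}^2.$$ Then $u$ is constant in $\mathbb{R}^2$.
   Context: For $1\le p\le 2$, $\Gamma_p:=\{(\lambda_1,\lambda_2)\in\mathbb{R}^2:\lambda_2>(p-2)\lambda_1,\ \lambda_1>(p-2)\lambda_2\}$. For a $C^2$ function $u$ on an open subset of $\mathbb{R}^2$, $$A^u=-\frac{\nabla^2u}{e^u}+\frac{1}{2}\frac{du\otimes du}{e^u}-\frac{1}{4}\frac{|\nabla u|^2}{e^u}I,$$ and $\lambda(A^u)$ denotes the eigenvalues of the symmetric matrix $A^u$. Viscosity solutions: let $\Omega\subset\mathbb{R}^2$ be open. An upper semicontinuous $u:\Omega\to\mathbb{R}\cup\{-\infty\}$, $u\not\equiv-\infty$, is a viscosity subsolution of $\lambda(A^u)\in\partial\Gamma$ in $\Omega$ if for any $x_0\in\Omega$ and $\varphi\in C^2(\Omega)$ with $(u-\varphi)(x_0)=0$ and $u-\varphi\le 0$ near $x_0$, one has $\lambda(A^\varphi(x_0))\in\mathbb{R}^2\setminus\Gamma$. A lower semicontinuous $u:\Omega\to\mathbb{R}\cup\{+\infty\}$, $u\not\equiv+\infty$, is a viscosity supersolution if for any $x_0\in\Omega$ and $\varphi\in C^2(\Omega)$ with $(u-\varphi)(x_0)=0$ and $u-\varphi\ge 0$ near $x_0$, one has $\lambda(A^\varphi(x_0))\in\bar\Gamma$. A viscosity solution is a function that is both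 a viscosity subsolution and a viscosity supersolution. *)

(* Defs.v *)
From mathcomp Require Import all_boot all_order all_algebra.
From mathcomp Require Import all_classical all_reals all_analysis.
Import Order.TTheory GRing.Theory Num.Theory.
Import numFieldNormedType.Exports.

Set Implicit Arguments.
Unset Strict Implicit.
Unset Printing Implicit Defensive.

Local Open Scope classical_set_scope.
Local Open Scope ring_scope.

Section defs.
Context {R : realType}.
Local Notation plane := 'rV[R]_2.
Implicit Types (Omega : set plane) (Gamma : set (R * R)) (f phi : plane -> R).

Definition partial (i : 'I_2) f : plane -> R := 'D_(delta_mx 0 i) f.

Definition grad f (x : plane) : plane := \row_i partial i f x.

Definition hess f (x : plane) : 'M[R]_2 :=
  \matrix_(i, j) partial i (partial j f) x.

(* Functions on an open Omega are total functions on the plane; only their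
   values on Omega matter. *)
Definition C2_on Omega f := forall x, Omega x ->
  [/\ {for x, continuous f},
      forall i, derivable f x (delta_mx 0 i) /\
                {for x, continuous (partial i f)}
    & forall i j, derivable (partial i f) x (delta_mx 0 j) /\
                  {for x, continuous (partial j (partial i f))}].

(* |grad f|^2 is spelled out: the library norm on row vectors is the sup norm.
   As grad f x is a row, df (x) df is (grad f x)^T *m grad f x. *)
Definition Amx f (x : plane) : 'M[R]_2 :=
  - ((expR (f x))^-1 *: hess f x)
  + (2^-1 / expR (f x)) *: ((grad f x)^T *m grad f x)
  - (4^-1 * (\sum_i grad f x 0 i ^+ 2) / expR (f x)) *: 1%:M.

Definition Gamma_p (p : R) : set (R * R) :=
  [set l | l.2 > (p - 2) * l.1 /\ l.1 > (p - 2) * l.2].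

(* lambda(A) \in S, the eigenvalues being counted with multiplicity. Their order
   is left free, so this is meant for sets S invariant under swapping the two
   coordinates, such as Gamma_p p, its closure and its complement. *)
Definition eigenvalues_in (A : 'M[R]_2) (S : set (R * R)) :=
  exists l : R * R,
    char_poly A = ('X - l.1%:P) * ('X - l.2%:P) /\ S l.

Definition usc_on Omega (u : plane -> \bar R) :=
  forall x, Omega x -> forall a : R, (u x < a%:E)%E ->
    \forall y \near x, Omega y -> (u y < a%:E)%E.

Definition lsc_on Omega (u : plane -> \bar R) :=
  forall x, Omega x -> forall a : R, (a%:E < u x)%E ->
    \forall y \near x, Omega y -> (a%:E < u y)%E.

Definition viscosity_subsolution Gamma Omega (u : plane -> \bar R) :=
  [/\ forall x, Omega x -> u x != +oo%E,
      exists2 x, Omega x & u x != -oo%E,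
      usc_on Omega u
    & forall x0 phi, Omega x0 -> C2_on Omega phi ->
        (u x0 - (phi x0)%:E = 0)%E ->
        (\forall x \near x0, Omega x -> (u x - (phi x)%:E <= 0)%E) ->
        eigenvalues_in (Amx phi x0) (~` Gamma)].

Definition viscosity_supersolution Gamma Omega (u : plane -> \bar R) :=
  [/\ forall x, Omega x -> u x != -oo%E,
      exists2 x, Omega x & u x != +oo%E,
      lsc_on Omega u
    & forall x0 phi, Omega x0 -> C2_on Omega phi ->
        (u x0 - (phi x0)%:E = 0)%E ->
        (\forall x \near x0, Omega x -> (0 <= u x - (phi x)%:E)%E) ->
        eigenvalues_in (Amx phi x0) (closure Gamma)].

(* Viscosity solution of lambda(A^u) \in \partial Gamma in the open set Omega. *)
Definition viscosity_solution Gamma Omega (u : plane -> \bar R) :=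
  viscosity_subsolution Gamma Omega u /\ viscosity_supersolution Gamma Omega u.

End defs.

(* Main.v *)
Require Import Defs.
From mathcomp Require Import all_boot all_order all_algebra.
From mathcomp Require Import all_classical all_reals all_analysis.
From mathcomp Require Import ring lra.
Import Order.TTheory GRing.Theory Num.Theory.
Import numFieldNormedType.Exports.
Local Open Scope classical_set_scope.
Local Open Scope ring_scope.

(** Put [w = exp (- u / 2)].  Then [A^u = 2 w (hess w) - |grad w|^2 I], and the
    equation is invariant under Moebius maps.  Away from the pole it has the
    radial solutions [w = (a + b r^g)^(2 / g)] with [g = p - 1] and [a, b > 0];
    for [0 < |g| < p - 1] and [a b] nonzero the same formula gives functions
    whose [A] lies strictly outside the closure of Gamma ([barrier_lower_jet],
    [supersolution_no_barrier_touch]).  They are barriers from above for [w],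
    and [W = w^(g / 2) = exp (- g u / 4)] turns them into the cones
    [a + b |x - y|^g].

    Three facts follow from the supersolution property.
    - Growth ([log_growth]): [w = O(|x|^2)], by comparison on an annulus with
      the barrier of exponent [- g], which blows up on the outer circle; the
      circle is then sent to infinity.
    - Comparison with cones ([cone_comparison]): if [W <= K |x - y|^g] for [x]
      far away, then [W x <= W y + K |x - y|^g] for every [x].
    - Two poles ([two_pole_bound]): [log w] is subharmonic, so a bound for [w]
      on two unit discs with far apart centres [y] and [z], together with the
      growth [O(|x|^2)], gives [w <= c |x - y| |x - z|] outside the discs; for
      a fixed bound on the discs, [c] tends to 0 as [|y - z|] grows.

    The subsolution property enters once ([circle_ge_center]): a small concave
    paraboloid has [A] inside Gamma, hence [u] satisfies a maximum principle and
    every circle about [y] carries a point [z] with [u y <= u z], that is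
    [W z <= W y].  Growth and comparison with cones bound [W] on the unit discs
    about [y] and [z] by a constant that does not depend on [z].  Sending [z] to
    infinity, the two-pole bound yields [W = o(|x|^g)] ([conformal_sublinear]).
    Comparison with cones then holds for every [K > 0], so [W x <= W y] for all
    [x] and [y].

    Barriers are singular at their poles, whereas test functions have to be of
    class C2 on the whole plane; for this reason a contact is only used through
    its second order Taylor polynomial, lowered by a small multiple of
    [|x - x0|^2] (predicate [lower_jet]). *)

(** * Quadratic test functions *)
Definition quadratic {R : realType} (x0 : 'rV[R]_2) (c l1 l2 a b d : R)
    (x : 'rV[R]_2) : R :=
  let h := x 0 0 - x0 0 0 in let k := x 0 1 - x0 0 1 in
  c + l1 * h + l2 * k + (a * h ^+ 2 + 2 * b * h * k + d * k ^+ 2) / 2.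

Lemma quadratic_center {R : realType} (x0 : 'rV[R]_2) (c l1 l2 a b d : R) :
  quadratic x0 c l1 l2 a b d x0 = c.
Proof. by rewrite /quadratic !subrr expr0n /= !mulr0 !addr0 mul0r addr0. Qed.

Lemma is_derive_coord {R : realType} (i : 'I_2) (x v : 'rV[R]_2) :
  is_derive x v (fun y : 'rV[R]_2 => y 0 i) (v 0 i).
Proof.
have @f : {linear 'rV[R]_2 -> R}.
  by exists (fun y : 'rV[R]_2 => y 0 i); do 2![eexists]; do ?[constructor];
     rewrite ?mxE// => ? *; rewrite ?mxE//; move=> ?; rewrite !mxE.
have cf : continuous f by exact: coord_continuous.
have df : differentiable f x by exact: linear_differentiable.
rewrite -[X in is_derive _ _ X]/(f : _ -> _).
split; first exact: diff_derivable.
by rewrite deriveE// diff_lin.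
Qed.

Lemma ord2_cases (i : 'I_2) : i = 0 \/ i = 1.
Proof. by case: i => [[|[|//]] ?]; [left|right]; apply/val_inj. Qed.

Lemma is_derive_quadratic {R : realType} (x0 : 'rV[R]_2) (c l1 l2 a b d : R)
    (x v : 'rV[R]_2) :
  is_derive x v (quadratic x0 c l1 l2 a b d)
    (quadratic x0 (l1 * v 0 0 + l2 * v 0 1) (a * v 0 0 + b * v 0 1)
       (b * v 0 0 + d * v 0 1) 0 0 0 x).
Proof.
pose h := fun y : 'rV[R]_2 => y 0 0 - x0 0 0.
pose k := fun y : 'rV[R]_2 => y 0 1 - x0 0 1.
have D (i : 'I_2) : is_derive x v (fun y => y 0 i - x0 0 i) (v 0 i).
  have := is_deriveB (is_derive_coord i x v) (is_derive_cst (x0 0 i) x v).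
  by rewrite subr0.
have Dh : is_derive x v h (v 0 0) := D 0.
have Dk : is_derive x v k (v 0 1) := D 1.
have -> : quadratic x0 c l1 l2 a b d =
    cst c + l1 *: h + l2 *: k + (a / 2) *: (h * h) + b *: (h * k)
     + (d / 2) *: (k * k).
  apply/funext => y; rewrite /quadratic -/(h y) -/(k y) !fctE /GRing.scale /=.
  by move: (h y) (k y) => H K; field.
have DL := is_deriveD (is_deriveD (is_derive_cst c x v) (is_deriveZ l1 Dh))
  (is_deriveZ l2 Dk).
have DQ := is_deriveD (is_deriveD (is_deriveD DL
  (is_deriveZ (a / 2) (is_deriveM Dh Dh))) (is_deriveZ b (is_deriveM Dh Dk)))
  (is_deriveZ (d / 2) (is_deriveM Dk Dk)).
apply: (is_derive_eq DQ).
rewrite /quadratic -/(h x) -/(k x) /GRing.scale /=.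
by move: (h x) (k x) (v 0 0) (v 0 1) => H K V W; field.
Qed.

Lemma partial_quadratic {R : realType} (x0 : 'rV[R]_2) (c l1 l2 a b d : R) :
  (partial 0 (quadratic x0 c l1 l2 a b d) = quadratic x0 l1 a b 0 0 0) *
  (partial 1 (quadratic x0 c l1 l2 a b d) = quadratic x0 l2 b d 0 0 0).
Proof.
split; apply/funext => x; rewrite /partial.
- have D := is_derive_quadratic x0 c l1 l2 a b d x (delta_mx 0 0).
  by rewrite derive_val !mxE /= !mulr1 !mulr0 !addr0.
- have D := is_derive_quadratic x0 c l1 l2 a b d x (delta_mx 0 1).
  by rewrite derive_val !mxE /= !mulr1 !mulr0 !add0r.
Qed.

Lemma continuous_quadratic {R : realType} (x0 : 'rV[R]_2) (c l1 l2 a b d : R) :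
  continuous (quadratic x0 c l1 l2 a b d).
Proof.
move=> x; rewrite /quadratic.
have C i : {for x, continuous (fun y : 'rV[R]_2 => y 0 i - x0 0 i)}.
  by apply: continuousB; [exact: coord_continuous|exact: cst_continuous].
have M (f g : 'rV[R]_2 -> R) : {for x, continuous f} -> {for x, continuous g} ->
  {for x, continuous (fun y => f y * g y)} by move=> ? ?; exact: continuousM.
have S (f g : 'rV[R]_2 -> R) : {for x, continuous f} -> {for x, continuous g} ->
  {for x, continuous (fun y => f y + g y)} by move=> ? ?; exact: continuousD.
have C0 := C 0; have C1 := C 1.
have K (r : R) : {for x, continuous (fun _ : 'rV[R]_2 => r)}.
  exact: cst_continuous.
have X i : {for x, continuous (fun y : 'rV[R]_2 => (y 0 i - x0 0 i) ^+ 2)}.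
  exact: (M _ _ (C i) (C i)).
exact: (S _ _ (S _ _ (S _ _ (K c) (M _ _ (K l1) C0)) (M _ _ (K l2) C1))
  (M _ _ (S _ _ (S _ _ (M _ _ (K a) (X 0)) (M _ _ (M _ _ (K (2 * b)) C0) C1))
    (M _ _ (K d) (X 1))) (K 2^-1))).
Qed.

Lemma C2_quadratic {R : realType} (x0 : 'rV[R]_2) (c l1 l2 a b d : R) :
  C2_on [set: 'rV[R]_2] (quadratic x0 c l1 l2 a b d).
Proof.
move=> x _; have dq c' m1 m2 a' b' d' (i : 'I_2) :
    derivable (quadratic x0 c' m1 m2 a' b' d') x (delta_mx 0 i).
  by have [] := is_derive_quadratic x0 c' m1 m2 a' b' d' x (delta_mx 0 i).
split=> [|i|i j]; first exact: continuous_quadratic.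
- split=> //; case: (ord2_cases i) => ->;
    rewrite partial_quadratic; exact: continuous_quadratic.
- case: (ord2_cases i) => ->; rewrite partial_quadratic; split=> //;
    case: (ord2_cases j) => ->; rewrite partial_quadratic;
    exact: continuous_quadratic.
Qed.

(** The gradient terms [1/2 l l^T - 1/4 |l|^2 I] are trace-free in dimension
    two, which explains the form of the entries. *)
Lemma Amx_quadratic {R : realType} (x0 : 'rV[R]_2) (c l1 l2 a b d : R) :
  let A := Amx (quadratic x0 c l1 l2 a b d) x0 in
  let e := (expR c)^-1 in
  [/\ A 0 0 = e * (- a + (l1 ^+ 2 - l2 ^+ 2) / 4),
      A 1 1 = e * (- d + (l2 ^+ 2 - l1 ^+ 2) / 4),
      A 0 1 = e * (- b + l1 * l2 / 2)
    & A 1 0 = e * (- b + l1 * l2 / 2)].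
Proof.
set q := quadratic x0 c l1 l2 a b d.
have ev := @quadratic_center R x0.
have g0 : grad q x0 0 0 = l1 by rewrite mxE partial_quadratic ev.
have g1 : grad q x0 0 1 = l2 by rewrite mxE partial_quadratic ev.
have h00 : hess q x0 0 0 = a by rewrite mxE !partial_quadratic ev.
have h01 : hess q x0 0 1 = b by rewrite mxE !partial_quadratic ev.
have h10 : hess q x0 1 0 = b by rewrite mxE !partial_quadratic ev.
have h11 : hess q x0 1 1 = d by rewrite mxE !partial_quadratic ev.
have AE i j : Amx q x0 i j = - ((expR c)^-1 * hess q x0 i j)
    + (2^-1 / expR c) * (grad q x0 0 i * grad q x0 0 j)
    - (4^-1 * (grad q x0 0 0 ^+ 2 + grad q x0 0 1 ^+ 2) / expR c)
      * (i == j)%:R.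
  rewrite /Amx [q x0]ev !big_ord_recl big_ord0 addr0.
  rewrite (_ : lift ord0 ord0 = 1 :> 'I_2); last exact/val_inj.
  move: (grad q x0) (hess q x0) => G H.
  by rewrite !mxE big_ord1 !mxE.
have : expR c != 0 by rewrite gt_eqF ?expR_gt0.
cbv zeta; rewrite !AE g0 g1 h00 h01 h10 h11 !eqxx.
have -> : (0 == 1 :> 'I_2) = false by [].
have -> : (1 == 0 :> 'I_2) = false by [].
rewrite !mulr0n !mulr1n.
move: (expR c) {q ev g0 g1 h00 h01 h10 h11 AE} => E E0.
by split; field; rewrite E0.
Qed.

Lemma det_mx2 {F : comPzRingType} (A : 'M[F]_2) :
  \det A = A 0 0 * A 1 1 - A 0 1 * A 1 0.
Proof.
have L0 : lift 0 0 = 1 :> 'I_2 by exact/val_inj.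
have L1 : lift 1 0 = 0 :> 'I_2 by exact/val_inj.
rewrite (expand_det_row _ 0) big_ord_recl big_ord1 /cofactor !det_mx11 !mxE.
rewrite L0 L1 addn0 add0n expr0 expr1.
by move: (A 0 0) (A 1 1) (A 0 1) (A 1 0) => a b c d; rewrite mul1r mulN1r mulrN.
Qed.

Lemma char_poly2_roots {F : fieldType} (A : 'M[F]_2) (r s : F) :
  char_poly A = ('X - r%:P) * ('X - s%:P) ->
  \tr A = r + s /\ \det A = r * s.
Proof.
move=> e.
have e' : ('X - r%:P) * ('X - s%:P) = 'X^2 - (r + s) *: 'X + (r * s)%:P.
  by rewrite -mul_polyC polyCD polyCM; ring.
have := char_poly_trace A erefl; have := char_poly_det A.
rewrite e e' /= !coefD !coefN !coefZ !coefXn !coefX !coefC /=.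
rewrite expr2 mulrNN !mul1r mulr0 mulr1 oppr0 !add0r => -> h.
by split=> //; apply: oppr_inj; rewrite -h addr0.
Qed.

(** * The equation on second order jets *)

(** Trace and determinant of [exp c * A] at the centre of a quadratic polynomial
    with gradient [(l1, l2)] and Hessian [[a, b; b, d]]. *)
Definition jet_trace {R : realType} (a d : R) : R := - a - d.

Definition jet_det {R : realType} (l1 l2 a b d : R) : R :=
  (- a + (l1 ^+ 2 - l2 ^+ 2) / 4) * (- d + (l2 ^+ 2 - l1 ^+ 2) / 4)
  - (- b + l1 * l2 / 2) ^+ 2.

(** The product of the two linear forms that define [Gamma_p], evaluated at the
    eigenvalues: it is symmetric, hence a polynomial in the trace [T] and the
    determinant [D]. *)
Definition cone_disc {R : realType} (p T D : R) : R :=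
  (p - 1) ^+ 2 * D + (2 - p) * T ^+ 2.

Lemma cone_discE {R : realType} (p r s : R) :
  cone_disc p (r + s) (r * s) = (s - (p - 2) * r) * (r - (p - 2) * s).
Proof. by rewrite /cone_disc; ring. Qed.

Lemma eigenvalues_quadratic {R : realType} (x0 : 'rV[R]_2) (c l1 l2 a b d : R)
    (S : set (R * R)) :
  eigenvalues_in (Amx (quadratic x0 c l1 l2 a b d) x0) S ->
  exists r s, [/\ r + s = (expR c)^-1 * jet_trace a d,
    r * s = (expR c)^-1 ^+ 2 * jet_det l1 l2 a b d & S (r, s)].
Proof.
move=> [[r s] [/char_poly2_roots [tE dE] Srs]]; exists r, s; split=> //.
- rewrite -tE /mxtrace big_ord_recl big_ord1.
  have -> : lift ord0 ord0 = 1 :> 'I_2 by exact/val_inj.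
  have [-> -> _ _] := Amx_quadratic x0 c l1 l2 a b d.
  by move: (expR c) => E; rewrite /jet_trace; ring.
- rewrite -dE det_mx2; have [-> -> -> ->] := Amx_quadratic x0 c l1 l2 a b d.
  by move: (expR c)^-1 => E; rewrite /jet_det; ring.
Qed.

Lemma closure_Gamma_p {R : realType} (p : R) (l : R * R) :
  closure (Gamma_p p) l -> 0 <= l.2 - (p - 2) * l.1 /\ 0 <= l.1 - (p - 2) * l.2.
Proof.
have fC : continuous (fun m : R * R => m.2 - (p - 2) * m.1).
  move=> m; apply: cvgB; first exact: cvg_snd.
  by apply: cvgM; [exact: cvg_cst | exact: cvg_fst].
have gC : continuous (fun m : R * R => m.1 - (p - 2) * m.2).
  move=> m; apply: cvgB; first exact: cvg_fst.
  by apply: cvgM; [exact: cvg_cst | exact: cvg_snd].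
have cl (f : R * R -> R) : continuous f ->
    (forall m, Gamma_p p m -> 0 <= f m) -> closure (Gamma_p p) l -> 0 <= f l.
  move=> cf f0 cll.
  have Cf : closed (f @^-1` [set r | 0 <= r]).
    by apply: closed_comp; [move=> m _; exact: cf | exact: closed_ge].
  suff : (f @^-1` [set r | 0 <= r]) l by [].
  by rewrite ((closure_id _).1 Cf); exact: closure_subset cll.
move=> cll; split.
- by apply: (cl _ fC _ cll) => m [h _]; rewrite subr_ge0 ltW.
- by apply: (cl _ gC _ cll) => m [_ h]; rewrite subr_ge0 ltW.
Qed.

Lemma quadratic_ge0_limit {R : realType} (c0 c1 c2 : R) :
  (forall e, 0 < e -> 0 <= c0 + c1 * e + c2 * e ^+ 2) -> 0 <= c0.
Proof.
move=> h; rewrite leNgt; apply/negP => c0_lt0.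
pose K := `|c1| + `|c2| + 1.
have K_gt0 : 0 < K by rewrite ltr_wpDl // addr_ge0.
pose e := Num.min 1 (- c0 / (2 * K)).
have e_gt0 : 0 < e by rewrite lt_min ltr01 /= divr_gt0 ?oppr_gt0 // mulr_gt0.
have e_le1 : e <= 1 by rewrite ge_min lexx.
have eK : e * K <= - c0 / 2.
  have : e <= - c0 / (2 * K) by rewrite ge_min lexx orbT.
  rewrite -(ler_pM2r K_gt0) => /le_trans; apply.
  by rewrite le_eqVlt; apply/orP; left; apply/eqP; field; rewrite gt_eqF.
have h1 : c1 * e <= `|c1| * e by rewrite ler_pM2r // ler_norm.
have h2 : c2 * e ^+ 2 <= `|c2| * e.
  apply: (@le_trans _ _ (`|c2| * e ^+ 2)).
    by rewrite ler_wpM2r ?sqr_ge0 // ler_norm.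
  by rewrite ler_wpM2l // expr2 ler_piMl // ltW.
have := h e e_gt0; rewrite /K in eK; nra.
Qed.

(** The second order subjet of viscosity theory, with gradient [(l1, l2)] and
    Hessian [[a, b; b, d]].  Unlike contact with one C2 function, it can be read
    off from a Taylor expansion at [x0] alone. *)
Definition lower_jet {R : realType} (u : 'rV[R]_2 -> R) (x0 : 'rV[R]_2)
    (l1 l2 a b d : R) :=
  forall e, 0 < e -> \forall x \near x0,
    quadratic x0 (u x0) l1 l2 (a - 2 * e) b (d - 2 * e) x <= u x.

(** For each [e > 0] the lowered polynomial is an admissible test function; the
    resulting inequalities are polynomial in [e], and [e] tends to 0. *)
Lemma supersolution_jet {R : realType} (p : R) (u : 'rV[R]_2 -> R)
    (x0 : 'rV[R]_2) (l1 l2 a b d : R) :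
  1 < p <= 2 ->
  viscosity_supersolution (Gamma_p p) [set: 'rV[R]_2] (fun x => (u x)%:E) ->
  lower_jet u x0 l1 l2 a b d ->
  0 <= jet_trace a d /\ 0 <= cone_disc p (jet_trace a d) (jet_det l1 l2 a b d).
Proof.
move=> /andP[p1 p2] [_ _ _ usol] ujet.
have key e : 0 < e -> 0 <= jet_trace (a - 2 * e) (d - 2 * e) /\
    0 <= cone_disc p (jet_trace (a - 2 * e) (d - 2 * e))
           (jet_det l1 l2 (a - 2 * e) b (d - 2 * e)).
  move=> e0; set q := quadratic x0 (u x0) l1 l2 (a - 2 * e) b (d - 2 * e).
  have qx0 : q x0 = u x0 by exact: quadratic_center.
  have := usol x0 q I (C2_quadratic _ _ _ _ _ _ _).
  rewrite qx0 subee // => /(_ erefl).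
  have near_q : \forall x \near x0, [set: 'rV[R]_2] x ->
      (0 <= (u x)%:E - (q x)%:E)%E.
    near=> x => _; rewrite sube_ge0 // lee_fin; near: x; exact: ujet.
  move=> /(_ near_q) /eigenvalues_quadratic [r [s [rsT rsD /closure_Gamma_p]]].
  rewrite /= => -[h1 h2].
  have E0 : 0 < (expR (u x0))^-1 by rewrite invr_gt0 expR_gt0.
  move: ((expR (u x0))^-1) E0 rsT rsD => E E0 rsT rsD.
  split.
    rewrite -(pmulr_rge0 _ E0) -rsT; nra.
  rewrite -(pmulr_rge0 _ (exprn_gt0 2 E0)).
  set T := jet_trace _ _ in rsT *; set D := jet_det _ _ _ _ _ in rsD *.
  have -> : E ^+ 2 * cone_disc p T D = cone_disc p (E * T) (E ^+ 2 * D).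
    by rewrite /cone_disc; ring.
  by rewrite -rsT -rsD cone_discE mulr_ge0.
split.
  apply: (@quadratic_ge0_limit _ _ 4 0) => e /key [h _].
  rewrite (_ : _ + _ = jet_trace (a - 2 * e) (d - 2 * e)) //.
  by rewrite /jet_trace; ring.
set T := jet_trace a d; set D := jet_det l1 l2 a b d.
apply: (@quadratic_ge0_limit _ _ (2 * (p - 1) ^+ 2 * T + 8 * (2 - p) * T)
  (4 * (p - 1) ^+ 2 + 16 * (2 - p))) => e /key [_ h].
rewrite (_ : _ + _ = cone_disc p (jet_trace (a - 2 * e) (d - 2 * e))
  (jet_det l1 l2 (a - 2 * e) b (d - 2 * e))) //.
by rewrite /T /D /cone_disc /jet_trace /jet_det; field.
Unshelve. all: by end_near. Qed.

(** If both quantities were positive, the two linear forms defining [Gamma_p]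
    would have positive product and positive sum, the latter being
    [(3 - p) T]. *)
Lemma subsolution_quadratic {R : realType} (p : R) (u : 'rV[R]_2 -> R)
    (x0 : 'rV[R]_2) (l1 l2 a b d : R) :
  1 < p <= 2 ->
  viscosity_subsolution (Gamma_p p) [set: 'rV[R]_2] (fun x => (u x)%:E) ->
  (\forall x \near x0, u x <= quadratic x0 (u x0) l1 l2 a b d x) ->
  0 < jet_trace a d -> cone_disc p (jet_trace a d) (jet_det l1 l2 a b d) <= 0.
Proof.
move=> /andP[p1 p2] [_ _ _ usol] uq T_gt0.
set q := quadratic x0 (u x0) l1 l2 a b d.
have qx0 : q x0 = u x0 by exact: quadratic_center.
have := usol x0 q I (C2_quadratic _ _ _ _ _ _ _).
rewrite qx0 subee // => /(_ erefl).
have near_q : \forall x \near x0, [set: 'rV[R]_2] x ->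
    ((u x)%:E - (q x)%:E <= 0)%E.
  by near=> x => _; rewrite sube_le0 lee_fin; near: x.
move=> /(_ near_q) /eigenvalues_quadratic [r [s [rsT rsD nG]]].
have E0 : 0 < (expR (u x0))^-1 by rewrite invr_gt0 expR_gt0.
move: ((expR (u x0))^-1) E0 rsT rsD => E E0 rsT rsD.
rewrite leNgt; apply/negP => disc_gt0; apply: nG.
rewrite -(pmulr_rgt0 _ E0) -rsT in T_gt0.
move: disc_gt0; rewrite -(pmulr_rgt0 _ (exprn_gt0 2 E0)).
have -> : E ^+ 2 * cone_disc p (jet_trace a d) (jet_det l1 l2 a b d) =
    (s - (p - 2) * r) * (r - (p - 2) * s).
  by rewrite -cone_discE rsT rsD /cone_disc; ring.
have sum_gt0 : 0 < (s - (p - 2) * r) + (r - (p - 2) * s).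
  rewrite (_ : _ + _ = (3 - p) * (r + s)); last by ring.
  by rewrite mulr_gt0 //; lra.
move=> prod_gt0; rewrite /Gamma_p /= -subr_gt0 -(subr_gt0 (_ * s)).
move: prod_gt0 sum_gt0.
move: (s - (p - 2) * r) (r - (p - 2) * s) => m n; clear => mn0 msn0.
have [m0|m0] := ltP 0 m; first by split=> //; rewrite pmulr_rgt0 // in mn0.
by exfalso; nra.
Unshelve. all: by end_near. Qed.

(** * Second order expansions of radial functions *)
Definition lower_taylor2 {R : realType} (G : R -> R) (s0 G1 G2 : R) :=
  forall e, 0 < e -> \forall s \near s0,
    G s0 + G1 * (s - s0) + G2 / 2 * (s - s0) ^+ 2 - e * (s - s0) ^+ 2 <= G s.

(** Mean value theorem applied to the Taylor remainder, whose derivative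
    [G' s - G' s0 - G2 (s - s0)] is [o(s - s0)]. *)
Lemma taylor_young2 {R : realType} (G G' : R -> R) (s0 G2 : R) :
  (\forall s \near s0, is_derive (s : R) 1 G (G' s)) -> is_derive s0 1 G' G2 ->
  lower_taylor2 G s0 (G' s0) G2.
Proof.
move=> dG dG' e e0.
have /is_derive1_caratheodory [h [hE hc h0]] := dG'.
have nh : \forall s \near s0, `|h s - G2| <= e.
  move: hc => /cvgrPdist_le /(_ e e0); rewrite h0; apply: filterS => s.
  by rewrite distrC.
have /nbhs_ballP [r /= r0 rP] : \forall s \near s0,
    is_derive (s : R) 1 G (G' s) /\ `|h s - G2| <= e by apply: filterI.
apply/nbhs_ballP; exists r => //= s sr.
pose E := G - (G' s0 *: (id - cst s0))
  - (G2 / 2) *: ((id - cst s0) * (id - cst s0)).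
pose E' (y : R) := G' y - G' s0 - G2 * (y - s0).
have dE y : ball s0 r y -> is_derive y 1 E (E' y).
  move=> /rP [dGy _].
  have di : is_derive y 1 (id - cst s0) 1.
    have := is_deriveB (is_derive_id y 1) (is_derive_cst s0 y 1).
    by rewrite subr0.
  have D := is_deriveB (is_deriveB dGy (is_deriveZ (G' s0) di))
    (is_deriveZ (G2 / 2) (is_deriveM di di)).
  apply: (is_derive_eq D); rewrite /E' /GRing.scale /= !fctE.
  by move: (G' y) (G' s0) => u v; field.
have bE y : ball s0 r y -> `|E' y| <= e * `|y - s0|.
  move=> /rP [_ hy]; rewrite /E' hE -mulrBl normrM.
  by rewrite ler_wpM2r.
have Es0 : E s0 = G s0 by rewrite /E !fctE /GRing.scale /= subrr !mulr0 !subr0.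
have EsE : E s = G s - G' s0 * (s - s0) - G2 / 2 * (s - s0) ^+ 2.
  by rewrite /E !fctE /GRing.scale /= expr2.
suff : `|E s - E s0| <= e * (s - s0) ^+ 2.
  rewrite ler_norml => /andP[+ _]; rewrite EsE Es0.
  move: (G s) (G s0) (G' s0) ((s - s0) ^+ 2) (s - s0) => g g0 g' q d.
  by move=> ?; lra.
have itvball a b c : ball s0 r a -> ball s0 r b -> a <= c <= b -> ball s0 r c.
  rewrite -!ball_normE /= !ltr_norml => /andP[? ?] /andP[? ?] /andP[? ?].
  by apply/andP; split; lra.
have mvt a b : a < b -> ball s0 r a -> ball s0 r b ->
    exists2 c, c \in `]a, b[ & E b - E a = E' c * (b - a).
  move=> ab ba bb; apply: MVT => //.
    move=> c; rewrite in_itv /= => /andP[ac cb]; apply: dE.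
    by apply: (itvball a b) => //; rewrite !ltW.
  apply: derivable_within_continuous => c; rewrite in_itv /= => /andP[ac cb].
  by have [] := dE c (itvball a b c ba bb _); rewrite ?ac ?cb //.
have b0 : ball s0 r s0 by exact: ballxx.
have [s_lt|s_gt|->] := ltgtP s s0; last by rewrite !subrr normr0 expr0n mulr0.
- have [c] := mvt _ _ s_lt sr b0; rewrite in_itv /= => /andP[sc cs] Ec.
  have bc := bE c (itvball _ _ c sr b0 _).
  rewrite distrC Ec normrM.
  apply: (@le_trans _ _ (e * `|c - s0| * `|s0 - s|)).
    by rewrite ler_wpM2r // bc // !ltW.
  rewrite -mulrA ler_wpM2l ?ltW //.
  rewrite ltr0_norm ?subr_lt0 // gtr0_norm ?subr_gt0 //.
  by nra.
- have [c] := mvt _ _ s_gt b0 sr; rewrite in_itv /= => /andP[sc cs] Ec.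
  have bc := bE c (itvball _ _ c b0 sr _).
  rewrite Ec normrM.
  apply: (@le_trans _ _ (e * `|c - s0| * `|s - s0|)).
    by rewrite ler_wpM2r // bc // !ltW.
  rewrite -mulrA ler_wpM2l ?ltW // !gtr0_norm ?subr_gt0 //.
  by nra.
Qed.

Definition sqdist {R : realType} (y x : 'rV[R]_2) : R :=
  (x 0 0 - y 0 0) ^+ 2 + (x 0 1 - y 0 1) ^+ 2.

Lemma sqdist_quadratic {R : realType} (y : 'rV[R]_2) :
  sqdist y = quadratic y 0 0 0 2 0 2.
Proof.
apply/funext => x; rewrite /sqdist /quadratic.
by move: (x 0 0 - y 0 0) (x 0 1 - y 0 1) => h k; field.
Qed.

Lemma continuous_sqdist {R : realType} (y : 'rV[R]_2) : continuous (sqdist y).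
Proof. by rewrite sqdist_quadratic; exact: continuous_quadratic. Qed.

(** Chain rule: [sqdist y x - sqdist y x0] is [2 (h0, k0) . (x - x0)] plus
    [|x - x0|^2], and only terms of order at least three are discarded when it
    is substituted in the expansion of [G]. *)
Lemma radial_lower_jet {R : realType} (G : R -> R) (y x0 : 'rV[R]_2)
    (G1 G2 : R) :
  let h0 := x0 0 0 - y 0 0 in let k0 := x0 0 1 - y 0 1 in
  lower_taylor2 G (sqdist y x0) G1 G2 ->
  lower_jet (fun x => G (sqdist y x)) x0 (2 * G1 * h0) (2 * G1 * k0)
    (2 * G1 + 4 * G2 * h0 ^+ 2) (4 * G2 * h0 * k0) (2 * G1 + 4 * G2 * k0 ^+ 2).
Proof.
move=> h0 k0 GT e e0.
(* C bounds (sqdist y x - sqdist y x0)^2 / |x - x0|^2 when |x - x0| <= 1. *)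
pose C := 8 * (h0 ^+ 2 + k0 ^+ 2) + 2.
have C0 : 0 < C by rewrite ltr_wpDl // mulr_ge0 // addr_ge0 ?sqr_ge0.
have e'0 : 0 < e / (2 * C) by rewrite divr_gt0 // mulr_gt0.
have n1 : \forall x \near x0, let s := sqdist y x - sqdist y x0 in
    G (sqdist y x0) + G1 * s + G2 / 2 * s ^+ 2 - e / (2 * C) * s ^+ 2 <=
    G (sqdist y x) := continuous_sqdist y x0 _ (GT _ e'0).
(* q x is the factor that multiplies |x - x0|^2 in the cubic and quartic part of
   the composition; it vanishes at x0. *)
pose q := quadratic x0 0 (2 * G2 * h0) (2 * G2 * k0) G2 0 G2.
have qx0 : q x0 = 0 by exact: quadratic_center.
have n2 : \forall x \near x0, `|q x| <= e / 2.
  have := @continuous_quadratic R x0 0 (2 * G2 * h0) (2 * G2 * k0) G2 0 G2 x0.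
  move=> /cvgrPdist_le /(_ (e / 2)); rewrite -/q qx0.
  have e20 : 0 < e / 2 by rewrite divr_gt0.
  move=> /(_ e20); apply: filterS => x.
  by rewrite sub0r normrN.
have n3 : \forall x \near x0, sqdist x0 x <= 1.
  have := @continuous_sqdist R x0 x0; move=> /cvgrPdist_le /(_ 1 ltr01).
  apply: filterS => x; rewrite {1}/sqdist !subrr expr0n /= addr0 sub0r normrN.
  by rewrite ler_norml => /andP[].
apply: filterS (filterI n1 (filterI n2 n3)) => x [h1 [h2 h3]].
rewrite /q /quadratic in h2; rewrite {1}/sqdist in h3.
rewrite /sqdist /= in h1; rewrite /quadratic.
apply: le_trans h1.
set g := G (_ + _).
have hE : x 0 0 - y 0 0 = h0 + (x 0 0 - x0 0 0) by rewrite /h0; ring.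
have kE : x 0 1 - y 0 1 = k0 + (x 0 1 - x0 0 1) by rewrite /k0; ring.
rewrite -/h0 -/k0 hE kE.
move: h3 h2; rewrite ler_norml.
move: (x 0 0 - x0 0 0) (x 0 1 - x0 0 1) => h k h3 /andP[h2 _].
set r2 := h ^+ 2 + k ^+ 2 in h3 *.
have r20 : 0 <= r2 by rewrite addr_ge0 ?sqr_ge0.
pose dt := h0 * h + k0 * k.
have sE : (h0 + h) ^+ 2 + (k0 + k) ^+ 2 - (h0 ^+ 2 + k0 ^+ 2) = 2 * dt + r2.
  by rewrite /dt /r2; ring.
rewrite sE.
have cs : dt ^+ 2 <= (h0 ^+ 2 + k0 ^+ 2) * r2.
  rewrite -subr_ge0 (_ : _ - _ = (h0 * k - k0 * h) ^+ 2) ?sqr_ge0 //.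
  by rewrite /dt /r2; ring.
have sb : (2 * dt + r2) ^+ 2 <= C * r2.
  have : (2 * dt + r2) ^+ 2 <= 8 * dt ^+ 2 + 2 * r2 ^+ 2.
    rewrite -subr_ge0 (_ : _ - _ = (2 * dt - r2) ^+ 2) ?sqr_ge0 //; ring.
  have : r2 ^+ 2 <= r2 by rewrite expr2 ler_piMl.
  by rewrite /C; nra.
have eb : e / (2 * C) * (2 * dt + r2) ^+ 2 <= e / 2 * r2.
  apply: (@le_trans _ _ (e / (2 * C) * (C * r2))).
    by rewrite ler_wpM2l // ltW.
  by rewrite le_eqVlt; apply/orP; left; apply/eqP; field; rewrite gt_eqF.
have qE : 0 + 2 * G2 * h0 * h + 2 * G2 * k0 * k +
    (G2 * h ^+ 2 + 2 * 0 * h * k + G2 * k ^+ 2) / 2 = G2 / 2 * (4 * dt + r2).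
  by rewrite /dt /r2; field.
rewrite qE in h2.
have h2' : - (e / 2) * r2 <= G2 / 2 * (4 * dt + r2) * r2.
  by rewrite ler_wpM2r.
rewrite -subr_ge0.
rewrite (_ : _ - _ = G2 / 2 * (4 * dt + r2) * r2 + e * r2
   - e / (2 * C) * (2 * dt + r2) ^+ 2); first by lra.
by move: (e / (2 * C)) => e'; rewrite /dt /r2; field.
Qed.

Lemma lower_jet_touch {R : realType} (u g : 'rV[R]_2 -> R) (x0 : 'rV[R]_2)
    (l1 l2 a b d : R) :
  (\forall x \near x0, u x0 - g x0 <= u x - g x) ->
  lower_jet g x0 l1 l2 a b d -> lower_jet u x0 l1 l2 a b d.
Proof.
move=> ug gj e e0; near=> x.
have h1 : u x0 - g x0 <= u x - g x by near: x.
have h2 : quadratic x0 (g x0) l1 l2 (a - 2 * e) b (d - 2 * e) x <= g x.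
  by near: x; exact: gj.
move: h1 h2; rewrite /quadratic.
move: (_ / 2) (l1 * _) (l2 * _) => q m n; lra.
Unshelve. all: by end_near. Qed.

Lemma lower_jetD {R : realType} (f g : 'rV[R]_2 -> R) (x0 : 'rV[R]_2)
    (l1 l2 a b d l1' l2' a' b' d' : R) :
  lower_jet f x0 l1 l2 a b d -> lower_jet g x0 l1' l2' a' b' d' ->
  lower_jet (fun x => f x + g x) x0 (l1 + l1') (l2 + l2') (a + a') (b + b')
    (d + d').
Proof.
move=> fj gj e e0.
have e2 : 0 < e / 2 by rewrite divr_gt0.
have nf := fj _ e2; have ng := gj _ e2; near=> x.
have h1 : quadratic x0 (f x0) l1 l2 (a - 2 * (e / 2)) b (d - 2 * (e / 2)) x
  <= f x by near: x.
have h2 : quadratic x0 (g x0) l1' l2' (a' - 2 * (e / 2)) b' (d' - 2 * (e / 2)) x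
  <= g x by near: x.
apply: le_trans (lerD h1 h2).
rewrite le_eqVlt; apply/orP; left; apply/eqP; rewrite /quadratic.
by move: (x 0 0 - x0 0 0) (x 0 1 - x0 0 1) (f x0) (g x0) => h k F G; field.
Unshelve. all: by end_near. Qed.

Lemma lower_jetZ {R : realType} (f : 'rV[R]_2 -> R) (x0 : 'rV[R]_2)
    (A l1 l2 a b d : R) : 0 < A ->
  lower_jet f x0 l1 l2 a b d ->
  lower_jet (fun x => A * f x) x0 (A * l1) (A * l2) (A * a) (A * b) (A * d).
Proof.
move=> A0 fj e e0; near=> x.
have h : quadratic x0 (f x0) l1 l2 (a - 2 * (e / A)) b (d - 2 * (e / A)) x
  <= f x by near: x; apply: fj; rewrite divr_gt0.
move: h; rewrite -(ler_pM2l A0); apply: le_trans.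
rewrite le_eqVlt; apply/orP; left; apply/eqP; rewrite /quadratic.
move: (x 0 0 - x0 0 0) (x 0 1 - x0 0 1) (f x0) => h k F; field.
by rewrite gt_eqF.
Unshelve. all: by end_near. Qed.

(** * Radial barriers *)

(** In terms of the squared distance [s], the function [u] for which
    [exp (- u / 2) = (a + b r^g)^(2 / g)]. *)
Definition barrier {R : realType} (g a b s : R) : R :=
  - (4 / g) * ln (a + b * s `^ (g / 2)).

Lemma powRB1 {R : realType} (s q : R) : 0 < s -> s `^ (q - 1) = s `^ q / s.
Proof.
by move=> s0; rewrite powRB ?(gt_eqF s0) ?implybT // powRr1 // ltW.
Qed.

Lemma barrier_taylor {R : realType} (g a b s0 : R) :
  g != 0 -> 0 < s0 -> 0 < a + b * s0 `^ (g / 2) ->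
  let z := b * s0 `^ (g / 2) / (a + b * s0 `^ (g / 2)) in
  lower_taylor2 (barrier g a b) s0 (- 2 * z / s0)
    (- 2 * z * (g / 2 - 1 - g / 2 * z) / s0 ^+ 2).
Proof.
move=> g0 s0_gt0 f0_gt0 z.
pose f s := a + b * s `^ (g / 2).
pose P (s : R) := s `^ (g / 2).
have {}f0_gt0 : 0 < f s0 := f0_gt0.
have dP (s : R) : 0 < s -> is_derive s 1 P (g / 2 * P s / s).
  move=> s_gt0; have D := is_derive1_powR (g / 2) s_gt0.
  by apply: (is_derive_eq D); rewrite powRB1 // mulrA.
have df (s : R) : 0 < s -> is_derive s 1 f (b * (g / 2 * P s / s)).
  move=> s_gt0.
  have D := is_deriveD (is_derive_cst a s 1) (is_deriveZ b (dP s s_gt0)).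
  by apply: (is_derive_eq D); rewrite /GRing.scale /= add0r.
have dG (s : R) : 0 < s -> 0 < f s ->
    is_derive s 1 (barrier g a b) (- 2 * b * P s / (s * f s)).
  move=> s_gt0 fs_gt0.
  have Dln := @is_derive1_comp _ _ _ _ _ _ (is_derive1_ln fs_gt0) (df s s_gt0).
  have D := is_deriveZ (- (4 / g)) Dln.
  apply: (is_derive_eq D); rewrite /GRing.scale /=.
  move: (P s) (f s) fs_gt0 => Q F F0; field.
  by rewrite g0 !gt_eqF.
have G1E : - 2 * b * P s0 / (s0 * f s0) = - 2 * z / s0.
  rewrite /z -/(f s0) -/(P s0); move: (P s0) (f s0) f0_gt0 => Q F F0; field.
  by rewrite !gt_eqF.
rewrite -G1E; apply: (@taylor_young2 _ _ (fun s => - 2 * b * P s / (s * f s))).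
  have n1 : \forall s \near s0, 0 < s by exact: lt_nbhsr.
  have n2 : \forall s \near s0, 0 < f s.
    have cf : {for s0, continuous f}.
      apply: differentiable_continuous; apply/derivable1_diffP.
      by have [] := df s0 s0_gt0.
    by have := cf _ (lt_nbhsr f0_gt0).
  by apply: filterS (filterI n1 n2) => s [s_gt0 fs_gt0]; exact: dG.
have Dm : is_derive s0 1 (id * f) (f s0 + s0 * (b * (g / 2 * P s0 / s0))).
  have D := is_deriveM (is_derive_id s0 1) (df s0 s0_gt0).
  by apply: (is_derive_eq D); rewrite /GRing.scale /=; ring.
have m0 : (id * f) s0 != 0 by rewrite mulf_neq0 // gt_eqF.
have D := is_deriveM (is_deriveZ (- 2 * b) (dP s0 s0_gt0)) (is_deriveV m0 Dm).
apply: (is_derive_eq D).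
rewrite !fctE /GRing.scale /= /GRing.scale /= /z -/(f s0) -/(P s0).
move: (P s0) (f s0) f0_gt0 => Q F F0; field.
by rewrite !gt_eqF.
Qed.


(** The eigenvalues are [m] across the radius and [m + (2 G1^2 - 4 G2) s] along
    it. *)
Lemma radial_jet_det {R : realType} (G1 G2 h k : R) :
  let s := h ^+ 2 + k ^+ 2 in let m := - (2 * G1 + G1 ^+ 2 * s) in
  jet_det (2 * G1 * h) (2 * G1 * k) (2 * G1 + 4 * G2 * h ^+ 2) (4 * G2 * h * k)
    (2 * G1 + 4 * G2 * k ^+ 2) = m * (m + (2 * G1 ^+ 2 - 4 * G2) * s).
Proof. by rewrite /jet_det /=; field. Qed.

Lemma radial_jet_trace {R : realType} (G1 G2 h k : R) :
  jet_trace (2 * G1 + 4 * G2 * h ^+ 2) (2 * G1 + 4 * G2 * k ^+ 2) =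
  - (4 * G1 + 4 * G2 * (h ^+ 2 + k ^+ 2)).
Proof. by rewrite /jet_trace; ring. Qed.

(** The eigenvalue of [A] along the radius is [g - 1] times the one across it,
    called [m] here, and [m] has the sign of [a b]. *)
Lemma barrier_lower_jet {R : realType} (g a b : R) (y x0 : 'rV[R]_2) :
  g != 0 -> 0 < sqdist y x0 -> 0 < a + b * sqdist y x0 `^ (g / 2) ->
  let f := a + b * sqdist y x0 `^ (g / 2) in
  let m := 4 * (a * b * sqdist y x0 `^ (g / 2)) / (f ^+ 2 * sqdist y x0) in
  exists l1 l2 a' b' d', [/\ lower_jet (fun x => barrier g a b (sqdist y x)) x0
      l1 l2 a' b' d',
    jet_trace a' d' = g * m & jet_det l1 l2 a' b' d' = (g - 1) * m ^+ 2].
Proof.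
move=> g0 s_gt0 f_gt0 f m.
pose z := b * sqdist y x0 `^ (g / 2) / f.
pose G1 := - 2 * z / sqdist y x0.
pose G2 := - 2 * z * (g / 2 - 1 - g / 2 * z) / sqdist y x0 ^+ 2.
have J : lower_taylor2 (barrier g a b) (sqdist y x0) G1 G2.
  exact: barrier_taylor.
pose h := x0 0 0 - y 0 0; pose k := x0 0 1 - y 0 1.
exists (2 * G1 * h), (2 * G1 * k), (2 * G1 + 4 * G2 * h ^+ 2), (4 * G2 * h * k),
  (2 * G1 + 4 * G2 * k ^+ 2).
split; first exact: radial_lower_jet J.
- rewrite radial_jet_trace -[h ^+ 2 + _]/(sqdist y x0) /G1 /G2 /z /m /f.
  move: (sqdist y x0 `^ (g / 2)) (sqdist y x0) s_gt0 f_gt0 => P s s0 f0; field.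
  by rewrite !gt_eqF.
- rewrite radial_jet_det -[h ^+ 2 + _]/(sqdist y x0) /G1 /G2 /z /m /f.
  move: (sqdist y x0 `^ (g / 2)) (sqdist y x0) s_gt0 f_gt0 => P s s0 f0; field.
  by rewrite !gt_eqF.
Qed.

(** The eigenvalues are [m] and [(g - 1) m], so the symmetric product of the two
    forms defining [Gamma_p] equals
    [- m^2 (p - 1 - g) (1 + (2 - p) (g - 1))].  The first factor is positive
    because [g < p - 1], the second because [g > - (p - 1)] makes it at least
    [(p - 1)^2]. *)
Lemma supersolution_no_barrier_touch {R : realType} (p g a b : R)
    (u : 'rV[R]_2 -> R) (y x0 : 'rV[R]_2) :
  1 < p <= 2 ->
  viscosity_supersolution (Gamma_p p) [set: 'rV[R]_2] (fun x => (u x)%:E) ->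
  g != 0 -> `|g| < p - 1 -> a * b != 0 ->
  0 < sqdist y x0 -> 0 < a + b * sqdist y x0 `^ (g / 2) ->
  ~ \forall x \near x0, u x0 - barrier g a b (sqdist y x0) <=
      u x - barrier g a b (sqdist y x).
Proof.
move=> hp usol g0 gp ab0 s0 f0 touch.
have [l1 [l2 [a' [b' [d' [J JT JD]]]]]] := barrier_lower_jet _ _ _ _ _ g0 s0 f0.
have [_] := supersolution_jet _ _ _ _ _ _ _ _ hp usol
  (lower_jet_touch _ _ _ _ _ _ _ _ touch J).
rewrite JT JD.
set m := _ / _.
have m0 : 0 < m ^+ 2.
  have P0 : sqdist y x0 `^ (g / 2) != 0 by rewrite gt_eqF // powR_gt0.
  move: ab0; rewrite mulf_eq0 negb_or => /andP[a0 b0].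
  rewrite exprn_even_gt0 //= /m.
  by rewrite !mulf_neq0 ?invr_neq0 ?mulf_neq0 ?expf_neq0 ?(gt_eqF f0)
     ?(gt_eqF s0) ?pnatr_eq0.
have -> : cone_disc p (g * m) ((g - 1) * m ^+ 2) =
    - (m ^+ 2 * ((p - 1 - g) * (1 + (2 - p) * (g - 1)))).
  by rewrite /cone_disc; ring.
rewrite oppr_ge0 pmulr_rle0 //; apply/negP; rewrite -ltNge.
move: gp hp; rewrite ltr_norml => /andP[g1 g2] /andP[p1 p2].
rewrite mulr_gt0 ?subr_gt0 //.
nra.
Qed.

(** * Euclidean distance and compactness in the plane *)
Lemma sqdist_ge0 {R : realType} (y x : 'rV[R]_2) : 0 <= sqdist y x.
Proof. by rewrite addr_ge0 ?sqr_ge0. Qed.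

Lemma sqdistxx {R : realType} (x : 'rV[R]_2) : sqdist x x = 0.
Proof. by rewrite /sqdist !subrr expr0n addr0. Qed.

Lemma sqdist_eq0 {R : realType} (y x : 'rV[R]_2) : sqdist y x = 0 -> x = y.
Proof.
move/eqP; rewrite paddr_eq0 ?sqr_ge0 // !sqrf_eq0 !subr_eq0.
move=> /andP[/eqP h /eqP k]; apply/rowP => i.
by case: (ord2_cases i) => ->.
Qed.

Lemma sqdistC {R : realType} (y x : 'rV[R]_2) : sqdist y x = sqdist x y.
Proof.
rewrite /sqdist; move: (x 0 0) (x 0 1) (y 0 0) (y 0 1) => a b c d; ring.
Qed.

Lemma sqdist_triangle {R : realType} (y x z : 'rV[R]_2) :
  sqdist y x <= 2 * sqdist y z + 2 * sqdist z x.
Proof.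
rewrite /sqdist; move: (x 0 0) (x 0 1) (y 0 0) (y 0 1) (z 0 0) (z 0 1).
move=> a b c d e f; rewrite -subr_ge0.
rewrite (_ : _ - _ = (a + c - 2 * e) ^+ 2 + (b + d - 2 * f) ^+ 2); last by ring.
by rewrite addr_ge0 ?sqr_ge0.
Qed.

Lemma near_sqdist_gt {R : realType} (y x0 : 'rV[R]_2) (r : R) :
  r < sqdist y x0 -> \forall x \near x0, r < sqdist y x.
Proof. by move=> h; have := @continuous_sqdist R y x0 _ (lt_nbhsr h). Qed.

Lemma near_sqdist_lt {R : realType} (y x0 : 'rV[R]_2) (r : R) :
  sqdist y x0 < r -> \forall x \near x0, sqdist y x < r.
Proof. by move=> h; have := @continuous_sqdist R y x0 _ (lt_nbhsl h). Qed.

Lemma closed_sqdist_le {R : realType} (y : 'rV[R]_2) (r : R) :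
  closed [set x | sqdist y x <= r].
Proof.
apply: (@closed_comp _ _ (sqdist y) [set s | s <= r]); last exact: closed_le.
by move=> x _; exact: continuous_sqdist.
Qed.

Lemma closed_sqdist_ge {R : realType} (y : 'rV[R]_2) (r : R) :
  closed [set x | r <= sqdist y x].
Proof.
apply: (@closed_comp _ _ (sqdist y) [set s | r <= s]); last exact: closed_ge.
by move=> x _; exact: continuous_sqdist.
Qed.

Lemma compact_disc {R : realType} (y : 'rV[R]_2) (r : R) :
  compact [set x | sqdist y x <= r].
Proof.
apply: bounded_closed_compact; last exact: closed_sqdist_le.
exists (`|y| + (r + 1)); split; first exact: num_real.
move=> M yM x /= xr; apply: le_trans (ltW yM).
have r0 : 0 <= r := le_trans (sqdist_ge0 y x) xr.
have sq (t : R) : t ^+ 2 <= r -> `|t| <= r + 1.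
  move=> tr; rewrite ler_norml; apply/andP; split; nra.
have b (i : 'I_2) : `|x 0 i - y 0 i| <= r + 1.
  apply: sq; apply: le_trans xr; rewrite /sqdist.
  by case: (ord2_cases i) => ->; rewrite ?lerDl ?lerDr sqr_ge0.
have nxy : `|x - y| <= r + 1.
  rewrite [leLHS]/Num.norm /= mx_normrE; apply/bigmax_leP; split.
    by rewrite addr_ge0.
  by move=> [i j] _ /=; rewrite !mxE !ord1.
by rewrite -[x](subrK y) addrC (le_trans (ler_normD _ _)) // lerD2l.
Qed.

Lemma compact_min {R : realType} (f : 'rV[R]_2 -> R) (K : set 'rV[R]_2)
    (x1 : 'rV[R]_2) :
  compact K -> K x1 -> (forall x, K x -> {for x, continuous f}) ->
  exists2 x0, K x0 & forall x, K x -> f x0 <= f x.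
Proof.
move=> cK Kx1 cf.
have K0 : K !=set0 by exists x1.
have wf : {within K, continuous f}.
  by apply: continuous_in_subspaceT => x; rewrite inE; exact: cf.
have [x0 /set_mem Kx0 h] := EVT_min_rV K0 cK wf.
by exists x0 => // x Kx; apply: h; exact: mem_set.
Qed.

Lemma powR_large {R : realType} (q M : R) : 0 < q ->
  exists2 S0, 0 < S0 & forall s, S0 <= s -> M <= s `^ q.
Proof.
move=> q0; pose M' := Num.max M 1.
have M'0 : 0 < M' by rewrite lt_max ltr01 orbT.
exists (M' `^ q^-1); first exact: powR_gt0.
move=> s Ms; apply: (@le_trans _ _ M'); first by rewrite le_max lexx.
have -> : M' = (M' `^ q^-1) `^ q.
  by rewrite -powRrM mulVf ?gt_eqF // powRr1 // ltW.
apply: ge0_ler_powR => //; first exact: ltW.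
- by rewrite nnegrE powR_ge0.
- by rewrite nnegrE (le_trans _ Ms) // powR_ge0.
Qed.

Lemma continuous_powR_pos {R : realType} (q s : R) : 0 < s ->
  {for s, continuous (fun t => t `^ q)}.
Proof.
move=> s0; apply: differentiable_continuous; apply/derivable1_diffP.
by have [] := is_derive1_powR q s0.
Qed.

Lemma continuous_sqdist_powR {R : realType} (y : 'rV[R]_2) (q : R) : 0 < q ->
  continuous (fun x => sqdist y x `^ q).
Proof.
move=> q0 x; have [s0|] := ltP 0 (sqdist y x).
  apply: (@continuous_comp _ _ _ (sqdist y) (fun t => t `^ q)).
    exact: continuous_sqdist.
  exact: continuous_powR_pos.
move=> sle; have s0 : sqdist y x = 0.
  by apply/eqP; rewrite eq_le sle sqdist_ge0.
suff : sqdist y z `^ q @[z --> x] --> sqdist y x `^ q by [].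
apply/(@cvgrPdist_lt _ _ _ _ (nbhs_filter x)) => e e0.
rewrite s0 powR0 ?gt_eqF //.
have := @near_sqdist_lt R y x (e `^ q^-1).
rewrite s0 powR_gt0 // => /(_ isT); apply: filterS => z zs.
rewrite sub0r normrN ger0_norm ?powR_ge0 //.
have -> : e = (e `^ q^-1) `^ q.
  by rewrite -powRrM mulVf ?gt_eqF // powRr1 // ltW.
by apply: gt0_ltr_powR; rewrite ?nnegrE ?sqdist_ge0 ?powR_ge0.
Qed.

(** * Comparison on annuli and growth at infinity *)

(** The power [w^(g / 2)] of [w = exp (- u / 2)], for which the barriers of
    exponent [g] are cones. *)
Definition conformal {R : realType} (g : R) (u : 'rV[R]_2 -> R)
    (x : 'rV[R]_2) : R :=
  expR (- (g / 4) * u x).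

Lemma conformal_gt0 {R : realType} (g : R) (u : 'rV[R]_2 -> R) (x : 'rV[R]_2) :
  0 < conformal g u x.
Proof. exact: expR_gt0. Qed.

Lemma continuous_conformal {R : realType} (g : R) (u : 'rV[R]_2 -> R) :
  continuous u -> continuous (conformal g u).
Proof.
move=> cu x; apply: (@continuous_comp _ _ _ (fun x => - (g / 4) * u x) expR).
  by apply: continuousM; [exact: cst_continuous | exact: cu].
exact: continuous_expR.
Qed.

Lemma barrier_subE {R : realType} (g a b : R) (u : 'rV[R]_2 -> R)
    (y x : 'rV[R]_2) :
  g != 0 -> 0 < a + b * sqdist y x `^ (g / 2) ->
  u x - barrier g a b (sqdist y x) =
  - (4 / g) * ln (conformal g u x / (a + b * sqdist y x `^ (g / 2))).
Proof.
move=> g0 f0; rewrite ln_div ?posrE ?conformal_gt0 // /conformal expRK /barrier.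
by move: (ln _) (u x) => L U; field.
Qed.

Lemma barrier_subNE {R : realType} (g a b : R) (u : 'rV[R]_2 -> R)
    (y x : 'rV[R]_2) :
  g != 0 -> 0 < a + b * sqdist y x `^ (- g / 2) ->
  u x - barrier (- g) a b (sqdist y x) =
  - (4 / g) * ln (conformal g u x * (a + b * sqdist y x `^ (- g / 2))).
Proof.
move=> g0 f0; rewrite lnM ?posrE ?conformal_gt0 // /conformal expRK /barrier.
by move: (ln _) (u x) => L U; field.
Qed.

(** The factor that multiplies [conformal g u] is the reciprocal of a barrier
    that is infinite on the outer circle, so the product vanishes there; an
    interior maximum above [M] would be a contact with the barrier of exponent
    [- g]. *)
Lemma annulus_bound {R : realType} (p g : R) (u : 'rV[R]_2 -> R)
    (y : 'rV[R]_2) (S M : R) :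
  1 < p <= 2 -> continuous u ->
  viscosity_supersolution (Gamma_p p) [set: 'rV[R]_2] (fun x => (u x)%:E) ->
  0 < g < p - 1 -> 1 < S -> 0 <= M ->
  (forall x, sqdist y x = 1 -> conformal g u x <= M) ->
  forall x, 1 <= sqdist y x <= S ->
    conformal g u x * (sqdist y x `^ (- g / 2) - S `^ (- g / 2)) <= M.
Proof.
move=> hp cu usol /andP[g0 gp] S1 M0 WM x1 /andP[x1l x1r].
pose a := - S `^ (- g / 2).
have a0 : a < 0 by rewrite oppr_lt0 powR_gt0 // (lt_trans ltr01).
pose f x := a + 1 * sqdist y x `^ (- g / 2).
pose F x := conformal g u x * f x.
have fE x : sqdist y x `^ (- g / 2) - S `^ (- g / 2) = f x.
  by rewrite /f mul1r addrC.
rewrite fE -/(F x1) leNgt; apply/negP => Fx1.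
have cf x : 0 < sqdist y x -> {for x, continuous f}.
  move=> s0; apply: continuousD; first exact: cst_continuous.
  apply: continuousM; first exact: cst_continuous.
  apply: (@continuous_comp _ _ _ (sqdist y) (fun t => t `^ (- g / 2))).
    exact: continuous_sqdist.
  exact: continuous_powR_pos.
pose K := [set x | 1 <= sqdist y x] `&` [set x | sqdist y x <= S].
have cK : compact K.
  apply: (subclosed_compact _ (@compact_disc R y S)); last by move=> x [].
  apply: closedI; [exact: closed_sqdist_ge | exact: closed_sqdist_le].
have cF x : K x -> {for x, continuous (fun x => - F x)}.
  move=> [/= s1 _]; apply: continuousN; apply: continuousM.
    exact: continuous_conformal.
  by apply: cf; exact: lt_le_trans s1.
have [x0 [/= s1 sS] max0] := compact_min _ _ x1 cK (conj x1l x1r) cF.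
have Fx0 : M < F x0.
  by apply: lt_le_trans Fx1 _; rewrite -lerN2; apply: max0.
have f0 : 0 < f x0.
  by rewrite -(pmulr_rgt0 _ (conformal_gt0 g u x0)) (le_lt_trans M0).
have s1' : 1 < sqdist y x0.
  rewrite lt_neqAle s1 andbT; apply/eqP => s0; move: Fx0; apply/negP.
  rewrite -leNgt /F /f -s0 powR1 mulr1.
  apply: le_trans (WM x0 (esym s0)); rewrite ger_pMr ?conformal_gt0 //.
  by rewrite gerDr ltW.
have sS' : sqdist y x0 < S.
  rewrite lt_neqAle sS andbT; apply/eqP => s0; move: f0.
  by rewrite /f s0 /a mul1r addNr ltxx.
have s_gt0 : 0 < sqdist y x0 by exact: lt_trans s1'.
apply: (supersolution_no_barrier_touch _ (- g) a 1 _ y x0 hp usol) => //.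
- by rewrite oppr_eq0 gt_eqF.
- by rewrite normrN gtr0_norm.
- by rewrite mulr1 lt_eqF.
have n1 : \forall x \near x0, 0 < f x by exact: (cf x0 s_gt0 _ (lt_nbhsr f0)).
have n2 := near_sqdist_gt _ _ _ s1'; have n3 := near_sqdist_lt _ _ _ sS'.
apply: filterS (filterI n1 (filterI n2 n3)) => x [fx [sx1 sxS]].
rewrite !barrier_subNE ?gt_eqF // ler_nM2l; last first.
  by rewrite oppr_lt0 divr_gt0.
rewrite ler_ln ?posrE ?mulr_gt0 ?conformal_gt0 //.
by rewrite -lerN2; apply: max0; split; exact: ltW.
Qed.

Lemma conformal_le {R : realType} (g C s : R) (u : 'rV[R]_2 -> R)
    (x : 'rV[R]_2) :
  0 < g -> 0 < s -> - 2 * ln s - C <= u x ->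
  conformal g u x <= expR (g / 4 * C) * s `^ (g / 2).
Proof.
move=> g0 s0 h; rewrite /powR gt_eqF // -expRD ler_expR.
move: h; move: (ln s) (u x) => L U h.
have -> : g / 4 * C + g / 2 * L = - (g / 4) * (- 2 * L - C) by field.
by rewrite ler_nM2l // oppr_lt0 divr_gt0.
Qed.

(** The outer circle of [annulus_bound] is sent to infinity.  In terms of
    [w = exp (- u / 2)] the conclusion reads [w = O(|x - y|^2)]. *)
Lemma log_growth {R : realType} (p : R) (u : 'rV[R]_2 -> R) (y : 'rV[R]_2) :
  1 < p <= 2 -> continuous u ->
  viscosity_supersolution (Gamma_p p) [set: 'rV[R]_2] (fun x => (u x)%:E) ->
  exists C, forall x, 1 <= sqdist y x -> - 2 * ln (sqdist y x) - C <= u x.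
Proof.
move=> hp cu usol; have /andP[p1 _] := hp.
pose g := (p - 1) / 2.
have g0 : 0 < g by rewrite divr_gt0 // subr_gt0.
have gp : 0 < g < p - 1 by rewrite g0 /g; lra.
pose W := conformal g u.
have [c _ Wc] : exists2 c, [set x | sqdist y x <= 1] c &
    forall x, [set x | sqdist y x <= 1] x -> - W c <= - W x.
  apply: (compact_min _ _ y); first exact: compact_disc.
    by rewrite /= sqdistxx.
  by move=> x _; apply: continuousN; exact: continuous_conformal.
have Mpos : 0 < W c := conformal_gt0 g u c.
have WM x : sqdist y x = 1 -> W x <= W c.
  by move=> s1; rewrite -lerN2; apply: Wc; rewrite /= s1.
exists (4 / g * ln (W c)) => x s1.
have s0 : 0 < sqdist y x by exact: lt_le_trans s1.
have bound : W x * sqdist y x `^ (- g / 2) <= W c.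
  rewrite leNgt; apply/negP => gtM.
  pose dl := W x * sqdist y x `^ (- g / 2) - W c.
  have dl0 : 0 < dl by rewrite subr_gt0.
  have g20 : 0 < g / 2 by rewrite divr_gt0.
  have [S0 _ S0P] := powR_large _ (W x / dl + 1) g20.
  (* With this outer radius the term dropped in the limit is below dl. *)
  pose S := Num.max (Num.max (sqdist y x) 2) S0.
  have xS : sqdist y x <= S by rewrite !le_max lexx.
  have S2 : 1 < S by rewrite !lt_max ltr1n orbT.
  have hx : 1 <= sqdist y x <= S by rewrite s1.
  have := annulus_bound _ _ _ _ _ _ hp cu usol gp S2 (ltW Mpos) WM x hx.
  apply/negP; rewrite -ltNge mulrBr ltrBrDr -ltrBrDl -/(W x) -/dl.
  have : W x / dl + 1 <= S `^ (g / 2) by apply: S0P; rewrite !le_max lexx orbT.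
  rewrite mulNr powRN ltr_pdivrMr ?powR_gt0 ?(lt_trans _ S2) //.
  rewrite -(ler_pM2l dl0) mulrDr mulr1 mulrC divfK ?gt_eqF //.
  by apply: lt_le_trans; rewrite ltrDl.
have : ln (W x * sqdist y x `^ (- g / 2)) <= ln (W c).
  by rewrite ler_ln // posrE mulr_gt0 ?powR_gt0 ?conformal_gt0.
rewrite lnM ?posrE ?powR_gt0 ?conformal_gt0 // ln_powR /W /conformal expRK.
rewrite -/(conformal g u c) -/(W c).
move: (ln (sqdist y x)) (u x) (ln (W c)) => L U M h.
have g40 : 0 < g / 4 by rewrite divr_gt0.
rewrite -(ler_pM2l g40).
have -> : g / 4 * (- 2 * L - 4 / g * M) = - (g / 2) * L - M.
  by field; rewrite gt_eqF.
move: h; rewrite !mulNr; lra.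
Qed.

(** The constant [K] serves all centres: moving the centre changes the squared
    distance to far away points by a factor at most 4. *)
Lemma conformal_growth {R : realType} (p g : R) (u : 'rV[R]_2 -> R) :
  1 < p <= 2 -> continuous u ->
  viscosity_supersolution (Gamma_p p) [set: 'rV[R]_2] (fun x => (u x)%:E) ->
  0 < g ->
  exists2 K, 0 < K & forall y, exists S0, forall x, S0 <= sqdist y x ->
    conformal g u x <= K * sqdist y x `^ (g / 2).
Proof.
move=> hp cu usol g0.
have [C uC] := log_growth _ _ 0 hp cu usol.
exists (expR (g / 4 * C) * 4 `^ (g / 2)).
  by rewrite mulr_gt0 ?expR_gt0 ?powR_gt0.
move=> y; exists (2 * sqdist y 0 + 2) => x sx.
have t1 := sqdist_triangle y x 0; have t2 := sqdist_triangle 0 x y.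
have d0 := sqdist_ge0 y 0; rewrite (sqdistC 0 y) in t2.
have s1 : 1 <= sqdist 0 x by lra.
have s0 : 0 < sqdist 0 x by lra.
apply: le_trans (conformal_le _ _ _ _ _ g0 s0 (uC x s1)) _.
rewrite -[leRHS]mulrA ler_pM2l ?expR_gt0 // -powRM //; last by lra.
by apply: ge0_ler_powR; rewrite ?nnegrE; lra.
Qed.

(** Lift the cone by [e] at its vertex.  If it did not lie above
    [conformal g u], the quotient of the two would have a maximum larger than 1,
    neither at the vertex nor far away, and there [u] would touch a barrier. *)
Lemma cone_comparison {R : realType} (p g K : R) (u : 'rV[R]_2 -> R)
    (y : 'rV[R]_2) :
  1 < p <= 2 -> continuous u ->
  viscosity_supersolution (Gamma_p p) [set: 'rV[R]_2] (fun x => (u x)%:E) ->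
  0 < g < p - 1 -> 0 < K ->
  (exists S0, forall x, S0 <= sqdist y x ->
    conformal g u x <= K * sqdist y x `^ (g / 2)) ->
  forall x, conformal g u x <= conformal g u y + K * sqdist y x `^ (g / 2).
Proof.
move=> hp cu usol /andP[g0 gp] K0 [S0 far] x1.
have g20 : 0 < g / 2 by rewrite divr_gt0.
rewrite -lerBlDr; apply/ler_addgt0Pr => e e0.
rewrite lerBlDr leNgt; apply/negP => x1gt.
pose a := conformal g u y + e.
have a0 : 0 < a by rewrite addr_gt0 ?conformal_gt0.
pose f x := a + K * sqdist y x `^ (g / 2).
have f0 x : 0 < f x by rewrite ltr_pwDl // mulr_ge0 ?powR_ge0 // ltW.
pose F x := conformal g u x / f x.
have cf x : {for x, continuous f}.
  apply: continuousD; first exact: cst_continuous.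
  apply: continuousM; first exact: cst_continuous.
  exact: continuous_sqdist_powR.
pose S := Num.max S0 (sqdist y x1).
have cF x : [set x | sqdist y x <= S] x -> {for x, continuous (fun x => - F x)}.
  move=> _; apply: continuousN; apply: continuousM.
    exact: continuous_conformal.
  apply: continuousV; last exact: cf.
  by rewrite gt_eqF.
have [|x0 /= x0S max0] := compact_min _ _ x1 (@compact_disc R y S) _ cF.
  by rewrite /= le_max lexx orbT.
have F1 : 1 < F x0.
  have Fx1 : 1 < F x1 by rewrite ltr_pdivlMr // mul1r.
  apply: lt_le_trans Fx1 _; rewrite -lerN2; apply: max0.
  by rewrite le_max lexx orbT.
have Fx0 : f x0 < conformal g u x0 by move: F1; rewrite ltr_pdivlMr // mul1r.
have x0S0 : sqdist y x0 < S0.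
  rewrite ltNge; apply/negP => /far; apply/negP; rewrite -ltNge.
  by apply: lt_trans Fx0; rewrite /f ltrDr.
have s_gt0 : 0 < sqdist y x0.
  rewrite lt_neqAle sqdist_ge0 andbT eq_sym; apply/eqP => s0.
  move: Fx0; apply/negP; rewrite -leNgt (sqdist_eq0 _ _ s0) /f.
  by rewrite -addrA lerDl addr_ge0 // ?mulr_ge0 ?powR_ge0 // ltW.
apply: (supersolution_no_barrier_touch _ g a K _ y x0 hp usol) => //.
- by rewrite gt_eqF.
- by rewrite gtr0_norm.
- by rewrite mulf_neq0 // gt_eqF.
- exact: f0.
have n := near_sqdist_lt _ _ _ x0S0.
apply: filterS n => x xS0.
rewrite !barrier_subE ?gt_eqF ?f0 // ler_nM2l; last first.
  by rewrite oppr_lt0 divr_gt0.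
rewrite ler_ln ?posrE ?divr_gt0 ?conformal_gt0 ?f0 //.
rewrite -lerN2; apply: max0; rewrite /= le_max; apply/orP; left; exact: ltW.
Qed.

(** * The maximum principle and the two-pole bound *)

(** Otherwise a paraboloid [c - 2 b |x - y|^2] with small [b > 0] touches [u]
    from above inside the disc.  There [exp u * A] has the eigenvalues
    [4 b (1 - b s)] and [4 b (1 + b s)], where [s] is the squared distance to
    [y].  Both are positive when [b s < 1], and Gamma contains the positive
    quadrant because [p <= 2]. *)
Lemma circle_ge_center {R : realType} (p : R) (u : 'rV[R]_2 -> R)
    (y : 'rV[R]_2) (r : R) :
  1 < p <= 2 -> continuous u ->
  viscosity_subsolution (Gamma_p p) [set: 'rV[R]_2] (fun x => (u x)%:E) ->
  0 < r -> exists2 z, sqdist y z = r & u y <= u z.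
Proof.
move=> hp cu usol r0; apply: contrapT => no.
have lt_u z : sqdist y z = r -> u z < u y.
  by move=> zr; rewrite ltNge; apply/negP => zu; apply: no; exists z.
have cN x : {for x, continuous (fun x => - u x)}.
  by apply: continuousN; exact: cu.
have Kc : compact ([set x | r <= sqdist y x] `&` [set x | sqdist y x <= r]).
  apply: (subclosed_compact _ (@compact_disc R y r)); last by move=> x [].
  apply: closedI; [exact: closed_sqdist_ge | exact: closed_sqdist_le].
pose z1 : 'rV[R]_2 := y + Num.sqrt r *: delta_mx 0 0.
have z1r : sqdist y z1 = r.
  rewrite /sqdist !mxE /= mulr1 mulr0 addr0 subrr expr0n addr0.
  by rewrite addrAC subrr add0r sqr_sqrtr // ltW.
have [|c [/= c1 c2] cmax] :=
    compact_min (fun x => - u x) _ z1 Kc _ (fun x _ => cN x).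
  by rewrite /= z1r lexx.
have cr : sqdist y c = r by apply/eqP; rewrite eq_le c1 c2.
(* The first bound keeps the contact point off the circle, the second gives
   b s < 1 in the disc. *)
pose b := Num.min ((u y - u c) / (4 * r)) (1 / (2 * r)).
have uyc := lt_u c cr.
have b0 : 0 < b.
  by rewrite lt_min !divr_gt0 ?mulr_gt0 ?subr_gt0.
have br : b * r <= 1 / 2.
  have h : b <= 1 / (2 * r) by rewrite ge_min lexx orbT.
  have -> : 1 / 2 = 1 / (2 * r) * r by field; rewrite gt_eqF.
  by rewrite ler_pM2r.
have bu : 4 * (b * r) <= u y - u c.
  have h : b <= (u y - u c) / (4 * r) by rewrite ge_min lexx.
  have -> : u y - u c = 4 * ((u y - u c) / (4 * r) * r).
    by move: (u y - u c) => v; field; rewrite gt_eqF.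
  by rewrite ler_pM2l // ler_pM2r.
pose F x := - (u x + 2 * b * sqdist y x).
have cF x : {for x, continuous F}.
  apply: continuousN; apply: continuousD; first exact: cu.
  by apply: continuousM; [exact: cst_continuous | exact: continuous_sqdist].
have [|x0 /= x0r max0] :=
    compact_min F _ y (@compact_disc R y r) _ (fun x _ => cF x).
  by rewrite /= sqdistxx ltW.
have Fx0 : u y <= u x0 + 2 * b * sqdist y x0.
  have := max0 y; rewrite /= /F sqdistxx mulr0 addr0 lerN2; apply; exact: ltW.
have x0r' : sqdist y x0 < r.
  rewrite lt_neqAle x0r andbT; apply/eqP => e.
  have : - u c <= - u x0 by apply: cmax; rewrite /= e lexx.
  move: Fx0 bu uyc; rewrite e; move: (u x0) (u y) (u c) => A B C.
  by rewrite -mulrA; move: (b * r) => t ? ? ? ?; lra.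
set h0 := x0 0 0 - y 0 0; set k0 := x0 0 1 - y 0 1.
have touch : \forall x \near x0, u x <=
    quadratic x0 (u x0) (- 4 * b * h0) (- 4 * b * k0) (- 4 * b) 0 (- 4 * b) x.
  apply: filterS (near_sqdist_lt _ _ _ x0r') => x xr.
  have := max0 x (ltW xr); rewrite /F lerN2 => h.
  have E : quadratic x0 (u x0) (- 4 * b * h0) (- 4 * b * k0) (- 4 * b) 0
      (- 4 * b) x = u x0 + 2 * b * sqdist y x0 - 2 * b * sqdist y x.
    rewrite /quadratic /sqdist /h0 /k0.
    move: (u x0) (x 0 0) (x 0 1) (x0 0 0) (x0 0 1) (y 0 0) (y 0 1).
    by move=> U a1 a2 a3 a4 a5 a6; field.
  by rewrite E lerBrDr.
have JT : jet_trace (- 4 * b) (- 4 * b) = 8 * b by rewrite /jet_trace; ring.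
have JD h k : jet_det (- 4 * b * h) (- 4 * b * k) (- 4 * b) 0 (- 4 * b) =
    16 * b ^+ 2 * (1 - (b * (h ^+ 2 + k ^+ 2)) ^+ 2).
  by rewrite /jet_det; field.
have := subsolution_quadratic _ _ _ _ _ _ _ _ hp usol touch.
rewrite JT JD -[h0 ^+ 2 + _]/(sqdist y x0) mulr_gt0 // => /(_ isT).
apply/negP; rewrite -ltNge.
have bs0 : 0 <= b * sqdist y x0 by rewrite mulr_ge0 ?sqdist_ge0 // ltW.
have bs1 : b * sqdist y x0 < 1.
  have : b * sqdist y x0 < b * r by rewrite ltr_pM2l.
  by lra.
have D0 : 0 < 16 * b ^+ 2 * (1 - (b * sqdist y x0) ^+ 2).
  rewrite !mulr_gt0 ?exprn_gt0 // subr_gt0.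
  by rewrite expr_lt1.
have /andP[p1 p2] := hp.
rewrite /cone_disc; apply: ltr_wpDr.
  by rewrite mulr_ge0 ?sqr_ge0 // subr_ge0.
by apply: mulr_gt0 D0; rewrite exprn_gt0 // subr_gt0.
Qed.

(** The comparison function [- 2 A (ln (s1 - 1/2) + ln (s2 - 1/2))], where [s1]
    and [s2] are the squared distances to the poles, is a multiple of a sum of
    barriers of exponent 2, and the trace of its [A] is negative: it is the
    term 1/2 that gives the sign, as [ln s1 + ln s2] is harmonic.  Since
    [2 A > 1], the sum of [u] and of [2 A (ln (s1 - 1/2) + ln (s2 - 1/2))] tends
    to infinity with [x], so it has a minimum over the complement of the unit
    discs, which is attained on one of the two unit circles. *)
Lemma two_pole_strict {R : realType} (p : R) (u : 'rV[R]_2 -> R)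
    (y z : 'rV[R]_2) (A N C : R) :
  1 < p <= 2 -> continuous u ->
  viscosity_supersolution (Gamma_p p) [set: 'rV[R]_2] (fun x => (u x)%:E) ->
  (forall x, 1 <= sqdist y x -> - 2 * ln (sqdist y x) - C <= u x) ->
  (forall x, sqdist y x <= 1 -> - N <= u x) ->
  (forall x, sqdist z x <= 1 -> - N <= u x) ->
  4 <= sqdist y z -> 1 < 2 * A ->
  forall x, 1 <= sqdist y x -> 1 <= sqdist z x ->
    - N + 2 * A * (ln (2^-1) + ln (sqdist y z / 2 - 3 / 2)) <=
    u x + 2 * A * (ln (sqdist y x - 2^-1) + ln (sqdist z x - 2^-1)).
Proof.
move=> hp cu usol uC uNy uNz d4 A1 x1 x1y x1z.
set c := - N + _; pose L y x := ln (@sqdist R y x - 2^-1).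
pose E x := u x + 2 * A * (L y x + L z x).
rewrite -/(L y x1) -/(L z x1) -/(E x1) leNgt; apply/negP => Ex1.
pose d := sqdist y z.
(* For s1 >= S both s1 - 1/2 and s2 - 1/2 are at least s1 / 8. *)
pose S := Num.max (Num.max (4 * d) 4) (Num.max (sqdist y x1 + 1)
  (expR ((c + C + 4 * A * ln 8) / (4 * A - 2)))).
have far x : S <= sqdist y x -> c <= E x.
  rewrite /S !ge_max => /andP[/andP[s4d s4] /andP[_ sexp]].
  have t := sqdist_triangle y x z.
  have sz : sqdist y x / 4 <= sqdist z x by rewrite -/d in t; lra.
  have s0 : 0 < sqdist y x by lra.
  have l8 : ln (sqdist y x / 8) = ln (sqdist y x) - ln 8.
    by rewrite ln_div ?posrE.
  have Ly : ln (sqdist y x) - ln 8 <= L y x.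
    by rewrite -l8 ler_ln ?posrE; lra.
  have Lz : ln (sqdist y x) - ln 8 <= L z x.
    by rewrite -l8 ler_ln ?posrE; lra.
  have A2 : 0 < 4 * A - 2 by lra.
  have big : c + C + 4 * A * ln 8 <= (4 * A - 2) * ln (sqdist y x).
    rewrite [X in _ <= X]mulrC -ler_pdivrMr // -[X in X <= _]expRK.
    by rewrite ler_ln ?posrE ?expR_gt0.
  have uCx : - 2 * ln (sqdist y x) - C <= u x by apply: uC; lra.
  rewrite /E; move: (ln (sqdist y x)) (ln 8) (L y x) (L z x) (u x) Ly Lz big uCx.
  by move=> l e8 Y Z U; nra.
pose K := [set x | 1 <= sqdist y x] `&` [set x | 1 <= sqdist z x] `&`
  [set x | sqdist y x <= S].
have cK : compact K.
  apply: (subclosed_compact _ (@compact_disc R y S)); last by move=> x [].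
  apply: closedI; last exact: closed_sqdist_le.
  by apply: closedI; exact: closed_sqdist_ge.
have cL w x : 1 <= sqdist w x -> {for x, continuous (L w)}.
  move=> s1; rewrite /L.
  apply: (@continuous_comp _ _ _ (fun x => sqdist w x - 2^-1) (@ln R)).
    apply: continuousB; [exact: continuous_sqdist | exact: cst_continuous].
  by apply: continuous_ln; lra.
have cE x : K x -> {for x, continuous E}.
  move=> [[/= s1 s2] _]; apply: continuousD; first exact: cu.
  apply: continuousM; first exact: cst_continuous.
  by apply: continuousD; exact: cL.
have Kx1 : K x1.
  split; first by split.
  by rewrite /= /S !le_max lerDl ler01 !orbT.
have [x0 [[/= s1 s2] sS] min0] := compact_min _ _ _ cK Kx1 cE.
have Ex0 : E x0 < c := le_lt_trans (min0 _ Kx1) Ex1.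
have sS' : sqdist y x0 < S.
  by rewrite ltNge; apply/negP => /far; apply/negP; rewrite -ltNge.
have A0 : 0 <= 2 * A by lra.
have s1' : 1 < sqdist y x0.
  rewrite lt_neqAle s1 andbT; apply/eqP => e; move: Ex0; apply/negP.
  rewrite -leNgt /c /E; apply: lerD; first by apply: uNy; rewrite -e.
  apply: ler_wpM2l => //; apply: lerD; rewrite /L.
    by rewrite -e ler_ln ?posrE; lra.
  have := sqdist_triangle y z x0; rewrite -e (sqdistC x0 z) => t.
  by rewrite ler_ln ?posrE; lra.
have s2' : 1 < sqdist z x0.
  rewrite lt_neqAle s2 andbT; apply/eqP => e; move: Ex0; apply/negP.
  rewrite -leNgt /c /E; apply: lerD; first by apply: uNz; rewrite -e.
  apply: ler_wpM2l => //; rewrite addrC; apply: lerD; rewrite /L.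
    have := sqdist_triangle y z x0; rewrite (sqdistC x0 z) -e => t.
    by rewrite ler_ln ?posrE; lra.
  by rewrite -e ler_ln ?posrE; lra.
have Bf w x : 0 < sqdist w x -> - 2^-1 + 1 * sqdist w x `^ (2 / 2) =
    sqdist w x - 2^-1.
  by move=> s0; rewrite divff // powRr1 ?(ltW s0) // mul1r addrC.
have BL w x : 0 < sqdist w x -> barrier 2 (- 2^-1) 1 (sqdist w x) = - 2 * L w x.
  move=> s0; rewrite /barrier Bf // /L.
  by rewrite (_ : 4 / 2 = 2) //; lra.
have jet w : 1 < sqdist w x0 -> exists l1 l2 a b d, lower_jet
    (fun x => barrier 2 (- 2^-1) 1 (sqdist w x)) x0 l1 l2 a b d /\
    jet_trace a d < 0.
  move=> sw; have sw0 : 0 < sqdist w x0 by lra.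
  have fw0 : 0 < - 2^-1 + 1 * sqdist w x0 `^ (2 / 2) by rewrite Bf //; lra.
  have n2 : 2 != 0 :> R by [].
  have [l1 [l2 [a [b [d' [J JT _]]]]]] :=
    barrier_lower_jet _ _ _ _ _ n2 sw0 fw0.
  exists l1, l2, a, b, d'; split=> //; rewrite JT.
  have P0 : 0 < sqdist w x0 `^ (2 / 2) by rewrite powR_gt0.
  rewrite pmulr_rlt0 // ltr_pdivrMr ?mul0r; first by lra.
  by rewrite mulr_gt0 // exprn_gt0.
have [l1 [l2 [a [b [d1 [J1 T1]]]]]] := jet y s1'.
have [m1 [m2 [a' [b' [d2 [J2 T2]]]]]] := jet z s2'.
have Apos : 0 < A by lra.
have J := lower_jetZ _ _ _ _ _ _ _ _ Apos
  (lower_jetD _ _ _ _ _ _ _ _ _ _ _ _ _ J1 J2).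
pose B x := A * (barrier 2 (- 2^-1) 1 (sqdist y x) +
  barrier 2 (- 2^-1) 1 (sqdist z x)).
have EE x : 1 < sqdist y x -> 1 < sqdist z x -> u x - B x = E x.
  move=> h1 h2; rewrite /B !BL; [|lra|lra].
  by rewrite /E; move: (L y x) (L z x) (u x) => ? ? ?; ring.
have touch : \forall x \near x0, u x0 - B x0 <= u x - B x.
  have n1 := near_sqdist_gt _ _ _ s1'; have n2 := near_sqdist_gt _ _ _ s2'.
  have n3 := near_sqdist_lt _ _ _ sS'.
  apply: filterS (filterI n1 (filterI n2 n3)) => x [g1 [g2 g3]].
  rewrite !EE //; apply: min0; split; last exact: ltW.
  by split; exact: ltW.
have [+ _] := supersolution_jet _ _ _ _ _ _ _ _ hp usol
  (lower_jet_touch _ _ _ _ _ _ _ _ touch J).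
apply/negP; rewrite -ltNge.
have -> : jet_trace (A * (a + a')) (A * (d1 + d2)) =
    A * (jet_trace a d1 + jet_trace a' d2) by rewrite /jet_trace; ring.
by rewrite pmulr_rlt0 //; lra.
Qed.

(** [two_pole_strict] is affine in [A], so [2 A] may tend to 1. *)
Lemma two_pole_bound {R : realType} (p : R) (u : 'rV[R]_2 -> R)
    (y z : 'rV[R]_2) (N : R) :
  1 < p <= 2 -> continuous u ->
  viscosity_supersolution (Gamma_p p) [set: 'rV[R]_2] (fun x => (u x)%:E) ->
  (forall x, sqdist y x <= 1 -> - N <= u x) ->
  (forall x, sqdist z x <= 1 -> - N <= u x) ->
  4 <= sqdist y z ->
  forall x, 1 <= sqdist y x -> 1 <= sqdist z x ->
    - N + (ln (2^-1) + ln (sqdist y z / 2 - 3 / 2)) <=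
    u x + (ln (sqdist y x) + ln (sqdist z x)).
Proof.
move=> hp cu usol uNy uNz d4 x x1y x1z.
have [C uC] := log_growth _ _ y hp cu usol.
set a := ln (2^-1); set b := ln (sqdist y z / 2 - 3 / 2).
set c := ln (sqdist y x - 2^-1); set d := ln (sqdist z x - 2^-1).
have strict e : 0 < e -> 0 <=
    (u x + (c + d) - (- N + (a + b))) + (c + d - (a + b)) * e + 0 * e ^+ 2.
  move=> e0; have A1 : 1 < 2 * ((1 + e) / 2) by lra.
  have := two_pole_strict _ _ _ _ _ _ _ hp cu usol uC uNy uNz d4 A1 x x1y x1z.
  rewrite -/a -/b -/c -/d; move: a b c d (u x) => a b c d U h.
  rewrite -subr_ge0 in h; apply: le_trans h _.
  by rewrite le_eqVlt; apply/orP; left; apply/eqP; field.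
have := quadratic_ge0_limit _ _ _ strict; rewrite subr_ge0 => /le_trans; apply.
rewrite lerD2l lerD // ler_ln ?posrE; lra.
Qed.

(** * Liouville theorem *)

(** Let [z] be a point with [u y <= u z] on a circle about [y] of squared radius
    [r].  Growth and comparison with cones bound [u] from below on the unit
    discs about [y] and [z] by a constant [- N] independent of [z]; the two-pole
    bound then improves as [r] grows. *)
Lemma conformal_sublinear {R : realType} (p g e : R) (u : 'rV[R]_2 -> R)
    (y : 'rV[R]_2) :
  1 < p <= 2 -> continuous u ->
  viscosity_solution (Gamma_p p) [set: 'rV[R]_2] (fun x => (u x)%:E) ->
  0 < g < p - 1 -> 0 < e ->
  exists S0, forall x, S0 <= sqdist y x ->
    conformal g u x <= e * sqdist y x `^ (g / 2).
Proof.
move=> hp cu [usub usup] gp e0; have /andP[g0 _] := gp.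
have [K K0 growth] := conformal_growth _ _ _ hp cu usup g0.
pose N := 4 / g * ln (conformal g u y + K).
have disc w : conformal g u w <= conformal g u y ->
    forall x, sqdist w x <= 1 -> - N <= u x.
  move=> wy x wx.
  have := cone_comparison _ _ _ _ w hp cu usup gp K0 (growth w) x.
  have P1 : sqdist w x `^ (g / 2) <= 1.
    rewrite -[leRHS](congr1 (fun f => f (g / 2)) (@powR1 R)).
    apply: ge0_ler_powR; rewrite ?nnegrE ?sqdist_ge0 //.
    by rewrite divr_ge0 // ltW.
  have KP : K * sqdist w x `^ (g / 2) <= K by rewrite ger_pMr.
  move=> /le_trans /(_ (lerD wy KP)).
  have WK : 0 < conformal g u y + K by rewrite addr_gt0 ?conformal_gt0.
  rewrite -ler_ln ?posrE ?conformal_gt0 // {1}/conformal expRK /N.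
  have g40 : 0 < g / 4 by rewrite divr_gt0.
  move: (ln _) (u x) => M U h; rewrite -(ler_pM2l g40).
  have -> : g / 4 * - (4 / g * M) = - M by field; rewrite gt_eqF.
  by move: h; rewrite mulNr lerNl.
(* r is chosen so that ln (r / 2 - 3 / 2) absorbs N, the constants ln 2 that
   come from the unit circles and from |x - z|^2 <= 4 |x - y|^2, and the factor
   e. *)
pose B := expR (N + 2 * ln 2 + ln 2 - 4 / g * ln e).
pose r := 2 * B + 4.
have B0 : 0 < B by exact: expR_gt0.
have r0 : 0 < r by rewrite /r; lra.
have [z zr uyz] := circle_ge_center _ _ y _ hp cu usub r0.
have Wzy : conformal g u z <= conformal g u y.
  by rewrite /conformal ler_expR ler_nM2l // oppr_lt0 divr_gt0.
exists (2 * r + 2) => x sx.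
have t1 := sqdist_triangle y x z; have t2 := sqdist_triangle z x y.
rewrite (sqdistC z y) zr in t2; rewrite zr in t1.
have sy1 : 1 <= sqdist y x by lra.
have sz1 : 1 <= sqdist z x by lra.
have s0 : 0 < sqdist y x by lra.
have d4 : 4 <= sqdist y z by rewrite zr /r; lra.
have := two_pole_bound _ _ y z N hp cu usup (disc y (lexx _)) (disc z Wzy) d4
  x sy1 sz1.
rewrite zr => bound.
have lz : ln (sqdist z x) <= 2 * ln 2 + ln (sqdist y x).
  have -> : 2 * ln 2 = ln 4 :> R.
    by rewrite (_ : 4 = 2 * 2) ?lnM ?posrE //; lra.
  by rewrite -lnM ?posrE // ler_ln ?posrE; lra.
have lB : N + 2 * ln 2 + ln 2 - 4 / g * ln e <= ln (r / 2 - 3 / 2).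
  by rewrite -[leLHS]expRK -/B ler_ln ?posrE /r; lra.
have l2 : ln (2^-1) = - ln 2 :> R by rewrite lnV ?posrE.
have lower : - 2 * ln (sqdist y x) - 4 / g * ln e <= u x.
  move: bound lz lB; rewrite l2.
  move: (ln (sqdist y x)) (ln (sqdist z x)) (ln 2) (ln (r / 2 - _)) (u x).
  by move: (4 / g * ln e) => l ls lz l2' lB U b1 b2 b3; lra.
apply: le_trans (conformal_le _ _ _ _ _ g0 s0 lower) _.
have -> : g / 4 * (4 / g * ln e) = ln e.
  by move: (ln e) => l; field; rewrite gt_eqF.
by rewrite lnK.
Qed.

Theorem corollary1p10 (R : realType) (p : R) (u : 'rV[R]_2 -> R)
    (hp : 1 < p <= 2) (u_cont : continuous u)
    (u_sol : viscosity_solution (Gamma_p p) [set: 'rV[R]_2]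
               (fun x => (u x)%:E)) :
  exists c : R, forall x, u x = c.
Proof.
pose g := (p - 1) / 2.
have /andP[p1 _] := hp.
have g0 : 0 < g by rewrite divr_gt0 // subr_gt0.
have gp : 0 < g < p - 1 by rewrite g0 /g; lra.
have le_u x y : u y <= u x.
  suff : conformal g u x <= conformal g u y.
    by rewrite /conformal ler_expR ler_nM2l // oppr_lt0 divr_gt0.
  apply/ler_addgt0Pr => e e0.
  have P0 : 0 < sqdist y x `^ (g / 2) + 1 by rewrite ltr_wpDl ?powR_ge0.
  pose K := e / (sqdist y x `^ (g / 2) + 1).
  have K0 : 0 < K by exact: divr_gt0.
  have usup := u_sol.2.
  have := cone_comparison _ _ _ _ y hp u_cont usup gp K0
    (conformal_sublinear _ _ _ _ y hp u_cont u_sol gp K0) x.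
  move=> /le_trans; apply; rewrite lerD2l /K -mulrA ger_pMr //.
  by rewrite mulrC ler_pdivrMr // mul1r lerDl.
by exists (u 0) => x; apply/eqP; rewrite eq_le !le_u.
Qed.
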